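(* Let $X$ be a finite set and $\theta:[t_1,\infty)\to\Pi_X$ a sequence of partitions of $X$ with change points $t_1<\dots<t_M$. The Sankey diagram graph $S(\theta)$ is a strict 1-dimensional subcomplex of $\tilde K:=\tilde K^{t_1,t_M}$. In particular, $V_m=\tilde K^{t_m,t_m}$ and $E_m=\tilde K^{t_m,t_{m+1}}$ for all $m=1,\dots,M-1$. Hence $S(\theta)$ can be retrieved from the zigzag filtration $$\dots\hookleftarrow\tilde K^{t_m,t_m}\hookrightarrow\tilde K^{t_m,t_{m+1}}\hookleftarrow\tilde K^{t_{m+1},t_{m+1}}\hookrightarrow\dots,$$ which is a subfiltration of the nerve-based MCbiF.
   Context: $X$ is a finite set and $\Pi_X$ is the set of partitions of $X$ (into nonempty clusters); $\theta(t)_i$ denotes the $i$-th cluster of $\theta(t)$ (for a fixed enumeration). A sequence of partitions is a piecewise-constant map $\theta:[t_1,\infty)\to\Pi_X$ with change points $t_1<\dots<t_M$: $\theta(t)=\theta(t_m)$ for $t\in[t_m,t_{m+1})$, $1\le m\le M-1$, and $\theta(t)=\theta(t_M)$ for $t\ge t_M$. Sankey diagram: the $M$-layered graph $S(\theta)=(V=V_1\uplus\dots\uplus V_M,\ E=E_1\uplus\dots\uplus E_{M-1})$ with $V_m:=\{(m,i):1\le i\le|\theta(t_m)|\}$ and $E_m:=\{[(m,i),(m+1,j)]:\theta(t_m)_i\cap\theta(t_{m+1})_j\ne\emptyset\}$. It is regarded as a 1-dimensional simplicial complex by forgetting edge directions; $V_m$ is identified with the 0-dimensional complex on these vertices and,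 in the equality $E_m=\tilde K^{t_m,t_{m+1}}$, $E_m$ is identified with the graph $(V_m\uplus V_{m+1},E_m)$. Nerve-based MCbiF: let $A(\ell,m):=V_\ell\uplus\dots\uplus V_m$ for $1\le\ell\le m\le M$. With the convention $t_{M+1}=\infty$, for $s\in[t_\ell,t_{\ell+1})$ and $t\in[t_m,t_{m+1})$ with $s\le t$, put $$\tilde K^{s,t}:=\{\sigma\subseteq A(\ell,m):\sigma\ne\emptyset,\ \bigcap_{(n,i)\in\sigma}\theta(t_n)_i\ne\emptyset\}.$$ The family $(\tilde K^{s,t})_{t_1\le s\le t}$ is a bifiltration: $\tilde K^{s,t}\subseteq\tilde K^{s',t'}$ if $s\ge s'$ and $t\le t'$. A zigzag filtration is a sequence of simplicial complexes in which each consecutive pair is related by an inclusion in one of the two directions.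
   Formalization: ''Strict'' is stated only for M ≥ 3 and X nonempty (for M ≤ 2 or X empty, S(θ) equals K̃), and ''1-dimensional'' as dimension at most 1 always, and exactly 1 for M ≥ 2 and X nonempty (for M = 1 or X empty there are no edges). *)

(* Defs.v *)
(* Partitions of X are finsets of finsets; graphs and abstract simplicial
   complexes are finmap's {fset _}, on vertices (m, i) : nat * nat. *)
From HB Require Import structures.
From mathcomp Require Import all_boot all_order all_algebra.
From mathcomp Require Import finmap.
From mathcomp Require Import reals.

Set Implicit Arguments.
Unset Strict Implicit.
Unset Printing Implicit Defensive.

Import Order.TTheory GRing.Theory Num.Theory.
Local Open Scope fset_scope.
Local Open Scope ring_scope.

Section SimplicialComplexes.
Context {T : choiceType}.
Implicit Types (K L : {fset {fset T}}) (V : {fset T}) (E : {fset T * T}).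

Definition simplicial_complex K : Prop :=
  forall s : {fset T}, s \in K ->
    s != fset0 /\ forall r : {fset T}, r != fset0 -> r `<=` s -> r \in K.

Definition subcomplex L K : Prop :=
  [/\ simplicial_complex L, simplicial_complex K & L `<=` K].

(* A simplex with k vertices has dimension k - 1. *)
Definition dim_le K (d : nat) : Prop :=
  forall s : {fset T}, s \in K -> (#|` s| <= d.+1)%N.

Definition has_dim K (d : nat) : Prop :=
  dim_le K d /\ exists2 s : {fset T}, s \in K & #|` s| = d.+1.

(* Edge directions are forgotten. *)
Definition graph_complex V E : {fset {fset T}} :=
  [fset [fset v] | v in V] `|` [fset [fset e.1; e.2] | e in E].

Definition vertex_set K : {fset T} := \bigcup_(s <- K) s.

(* The k-th arrow points forward when fwd k holds, and backward otherwise. *)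
Definition zigzag_filtration (fwd : nat -> bool) (Z : seq {fset {fset T}}) : Prop :=
  (forall K, K \in Z -> simplicial_complex K) /\
  forall k : nat, (k.+1 < size Z)%N ->
    if fwd k then nth fset0 Z k `<=` nth fset0 Z k.+1
    else nth fset0 Z k.+1 `<=` nth fset0 Z k.

(* The order of a bifiltration: contravariant in the first parameter. *)
Definition bile {R : realType} (p q : R * R) : bool :=
  (q.1 <= p.1) && (p.2 <= q.2).

(* Z consists of members of the bifiltration K (indexed by t0 <= s <= t), and
   each of its arrows is one of the structure inclusions of K. *)
Definition subfiltration {R : realType} (t0 : R) (K : R -> R -> {fset {fset T}})
    (fwd : nat -> bool) (Z : seq {fset {fset T}}) : Prop :=
  exists p : seq (R * R),
    [/\ forall q, q \in p -> t0 <= q.1 <= q.2,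
        Z = [seq K q.1 q.2 | q <- p] &
        forall k : nat, (k.+1 < size p)%N ->
          if fwd k then bile (nth (0, 0) p k) (nth (0, 0) p k.+1)
          else bile (nth (0, 0) p k.+1) (nth (0, 0) p k)].

Record layered_graph := LayeredGraph {
  layers : seq {fset T};
  layer_edges : seq {fset T * T} }.

(* Layers are the vertex sets of the terms of even position of a zigzag; the
   edges between consecutive layers are the 1-simplices of the term in between,
   directed from the earlier layer to the later one. *)
Definition retrieve (Z : seq {fset {fset T}}) : layered_graph :=
  let V k := vertex_set (nth fset0 Z k.*2) in
  LayeredGraph
    (mkseq V (uphalf (size Z)))
    (mkseq (fun k => [fset e in V k `*` V k.+1 |
                        [fset e.1; e.2] \in nth fset0 Z k.*2.+1])
           (half (size Z))).

End SimplicialComplexes.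

Arguments layered_graph : clear implicits.

(* s lies in [t m, t (m + 1)[, with 1 <= m <= M and t (M + 1) = +oo. *)
Definition in_step {R : realType} (M : nat) (t : nat -> R) (m : nat) (s : R) : bool :=
  [&& (1 <= m <= M)%N, t m <= s & (m < M)%N ==> (s < t m.+1)].

(* Change points are t 1 < ... < t M; only the values of t on 1..M and of theta
   on [t 1, +oo[ are meaningful. *)
Record partition_sequence (R : realType) (X : finType) := PartitionSequence {
  theta :> R -> {set {set X}};
  nchange : nat;
  chpt : nat -> R;
  nchange_gt0 : (0 < nchange)%N;
  chpt_lt : forall m : nat, (1 <= m < nchange)%N -> chpt m < chpt m.+1;
  theta_partition : forall s : R, chpt 1%N <= s -> partition (theta s) [set: X];
  theta_step : forall (m : nat) (s : R),
    in_step nchange chpt m s -> theta s = theta (chpt m) }.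

(* An arbitrary but fixed enumeration of the clusters of every partition. *)
Record cluster_enumeration (X : finType) := ClusterEnumeration {
  clusters :> {set {set X}} -> seq {set X};
  clustersP : forall P : {set {set X}}, perm_eq (clusters P) (enum P) }.

Section MCbiF.
Context {R : realType} {X : finType}.
Variables (th : partition_sequence R X) (en : cluster_enumeration X).

Local Notation M := (nchange th).
Local Notation t := (chpt th).

(* A vertex (m, i) stands for the i-th cluster of theta (t m); m and i are
   1-based. *)
Definition cluster (v : nat * nat) : {set X} := nth set0 (en (th (t v.1))) v.2.-1.

Definition sankey_V (m : nat) : {fset nat * nat} :=
  [fset (m, i) | i in iota 1 #|th (t m)|].

Definition sankey_E (m : nat) : {fset (nat * nat) * (nat * nat)} :=
  [fset e in sankey_V m `*` sankey_V m.+1 |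
    (cluster e.1 :&: cluster e.2)%SET != set0].

Definition sankey : layered_graph (nat * nat)%type :=
  LayeredGraph [seq sankey_V m | m <- iota 1 M] [seq sankey_E m | m <- iota 1 M.-1].

Definition sankey_complex : {fset {fset nat * nat}} :=
  graph_complex (\bigcup_(V <- layers sankey) V) (\bigcup_(E <- layer_edges sankey) E).

Definition layer_range (l m : nat) : {fset nat * nat} :=
  \bigcup_(n <- index_iota l m.+1) sankey_V n.

(* The unique l with s in [t l, t (l + 1)[. *)
Definition step_of (s : R) : nat :=
  odflt ord0 [pick l : 'I_M.+1 | in_step M t l s].

(* Meaningful for t 1 <= s <= s' only. *)
Definition nerve_MCbiF (s s' : R) : {fset {fset nat * nat}} :=
  [fset sigma in fpowerset (layer_range (step_of s) (step_of s')) |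
    (sigma != fset0) && ((\bigcap_(v <- sigma) cluster v)%SET != set0)].

(* K(t1,t1), K(t1,t2), K(t2,t2), K(t2,t3), ..., K(tM,tM): 2M - 1 terms. *)
Definition sankey_zigzag : seq {fset {fset nat * nat}} :=
  mkseq (fun k => nerve_MCbiF (t k./2.+1) (t (uphalf k).+1)) (M.*2).-1.

End MCbiF.

(* Main.v *)
Require Import Defs.
From HB Require Import structures.
From mathcomp Require Import all_boot all_order all_algebra.
From mathcomp Require Import finmap.
From mathcomp Require Import reals.

(** Each point [x] of [X] lies in exactly one cluster of each partition, so it
    draws a track through the layers: [track x n] is the unique vertex of layer
    [n] whose cluster contains [x].  A set of clusters has a common point [x]
    exactly when all the corresponding vertices lie on the track of [x].  Hence
    the simplices of K(t_l, t_m) are the nonempty pieces, between the layers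
    [l] and [m], of the tracks (lemma [nerveP]), and every claim is read off
    from the number of layers that are available.

    With one layer a piece of track is a vertex, so K(t_m, t_m) is V_m; with
    two consecutive layers it is a vertex or a pair of consecutive points of a
    track, and the edges of E_m are precisely these pairs ([sankey_EP]), so
    K(t_m, t_(m+1)) is E_m.  The Sankey diagram collects these pieces, all of at
    most two points, inside K(t_1, t_M); with three layers, the first three
    points of any track form a triangle of K(t_1, t_M) outside the diagram.
    The arrows of the zigzag are inclusions because widening the range of
    layers only adds pieces of tracks ([nerve_mono]).  Finally the vertices of
    K(t_m, t_m) recover V_m, and the pairs joining two consecutive layers in
    K(t_m, t_(m+1)) recover E_m. *)

Set Implicit Arguments.
Unset Strict Implicit.
Unset Printing Implicit Defensive.

Import Order.TTheory GRing.Theory Num.Theory.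
Local Open Scope fset_scope.
Local Open Scope ring_scope.

(** * Finite graphs as simplicial complexes *)

Section GraphComplexes.
Context {T : choiceType}.
Implicit Types (V s : {fset T}) (E : {fset T * T}).

Lemma graph_complexP V E s :
  reflect ((exists2 v, v \in V & s = [fset v]) \/
           (exists2 e, e \in E & s = [fset e.1; e.2]))
          (s \in graph_complex V E).
Proof.
rewrite /graph_complex in_fsetU.
apply: (iffP orP) => [[/imfsetP|/imfsetP]|[?|?]]; [by left|by right| |].
  by left; apply/imfsetP.
by right; apply/imfsetP.
Qed.

Lemma sub_fset1 (v : T) s : s != fset0 -> s `<=` [fset v] -> s = [fset v].
Proof. by rewrite fsubset1 => /negPf-> /[!orbF] /eqP. Qed.

Lemma sub_fset2 (v w : T) s : s != fset0 -> s `<=` [fset v; w] ->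
  [\/ s = [fset v], s = [fset w] | s = [fset v; w]].
Proof.
move=> s0 /fsubsetP svw.
have sE z : z \in s -> z = v \/ z = w by move=> /svw /fset2P.
case: (boolP (v \in s)) => vs; last first.
  apply: Or32; apply: sub_fset1 => //; apply/fsubsetP => z zs.
  rewrite in_fset1; case: (sE z zs) => [zv|->//].
  by rewrite -zv zs in vs.
case: (boolP (w \in s)) => ws; last first.
  apply: Or31; apply: sub_fset1 => //; apply/fsubsetP => z zs.
  rewrite in_fset1; case: (sE z zs) => [->//|zw].
  by rewrite -zw zs in ws.
apply: Or33; apply/eqP; rewrite eqEfsubset; apply/andP; split.
  exact/fsubsetP.
by apply/fsubsetP => z /fset2P[]->.
Qed.

Lemma graph_simplicial V E :
  (forall e, e \in E -> (e.1 \in V) && (e.2 \in V)) ->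
  simplicial_complex (graph_complex V E).
Proof.
move=> EV s /graph_complexP[[v vV ->]|[e eE ->]]; split.
- by apply/fset0Pn; exists v; rewrite in_fset1.
- move=> r r0 /(sub_fset1 r0)->; apply/graph_complexP; left.
  by exists v.
- by apply/fset0Pn; exists e.1; rewrite in_fset2 eqxx.
have /andP[e1 e2] := EV _ eE.
move=> r r0 /(sub_fset2 r0)[]->; apply/graph_complexP.
- by left; exists e.1.
- by left; exists e.2.
- by right; exists e.
Qed.

Lemma graph_dim_le1 V E : dim_le (graph_complex V E) 1.
Proof.
move=> s /graph_complexP[[v _ ->]|[e _ ->]]; first by rewrite cardfs1.
by rewrite cardfs2; case: (_ != _).
Qed.

Lemma in_edges V (W : {fset T}) (L : {fset {fset T}}) e :
  (e \in [fset e in V `*` W | [fset e.1; e.2] \in L]) =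
  [&& e.1 \in V, e.2 \in W & [fset e.1; e.2] \in L].
Proof. by rewrite !inE /= andbA. Qed.

End GraphComplexes.

(** * Enumerated partitions *)

Lemma in_bigcap_seq (I : Type) (X : finType) (F : I -> {set X}) (r : seq I) (x : X) :
  (x \in (\bigcap_(i <- r) F i)%SET) = all (fun i => x \in F i) r.
Proof.
by elim: r => [|i r IH]; rewrite ?big_nil ?big_cons !inE //= IH.
Qed.

Lemma has_cluster (X : finType) (P : {set {set X}}) (s : seq {set X}) (x : X) :
  partition P [set: X]%SET -> perm_eq s (enum P) -> has (fun C : {set X} => x \in C) s.
Proof.
move=> pP sP; have: x \in cover P by rewrite (cover_partition pP) inE.
case/bigcupP => C CP xC; apply/hasP; exists C => //.
by rewrite (perm_mem sP) mem_enum.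
Qed.

(** Two clusters that contain [x] are equal because distinct clusters are
    disjoint; equal entries have equal indices because the enumeration lists
    each cluster once. *)
Lemma unique_cluster (X : finType) (P : {set {set X}}) (s : seq {set X}) (x : X) i :
  partition P [set: X]%SET -> perm_eq s (enum P) ->
  (i < size s)%N && (x \in nth set0 s i) = (i == find (fun C : {set X} => x \in C) s).
Proof.
move=> pP sP; have hx := has_cluster x pP sP.
have fs : (find (fun C : {set X} => x \in C) s < size s)%N by rewrite -has_find.
have xf := nth_find set0 hx.
apply/andP/eqP => [[is_ xi]|->]; last by [].
have sQ j : (j < size s)%N -> nth set0 s j \in P.
  by move=> js; rewrite -mem_enum -(perm_mem sP) mem_nth.
have us : uniq s by rewrite (perm_uniq sP) enum_uniq.
have /and3P[_ tP _] := pP.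
apply/eqP; rewrite -(nth_uniq set0 is_ fs us).
by rewrite -(def_pblock tP (sQ _ is_) xi) -(def_pblock tP (sQ _ fs) xf).
Qed.

(** * Change points *)

Section SankeyNerve.
Context {R : realType} {X : finType}.
Variables (th : partition_sequence R X) (en : cluster_enumeration X).

Local Notation M := (nchange th).
Local Notation t := (chpt th).
Local Notation K := (nerve_MCbiF th en).

Lemma chpt_le l m : (1 <= l)%N -> (l <= m)%N -> (m <= M)%N -> t l <= t m.
Proof.
move=> l1; elim: m => [|m IH]; first by rewrite leqn0 => /eqP->.
rewrite leq_eqVlt => /predU1P[->//|lm] mM.
apply: le_trans (IH lm (ltnW mM)) (ltW (chpt_lt _)).
by rewrite mM (leq_trans l1 lm).
Qed.

Lemma in_step_chpt l m : (1 <= m <= M)%N -> in_step M t l (t m) = (l == m).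
Proof.
move=> /andP[m1 mM]; apply/idP/eqP => [/and3P[/andP[l1 lM] tlm lt]|->].
  apply/eqP; case: (ltngtP l m) => // lm.
    move/implyP: lt => /(_ (leq_trans lm mM)).
    by rewrite ltNge (chpt_le _ lm mM).
  have := chpt_le (m := l) _ lm lM => /(_ isT) tml.
  have := @chpt_lt _ _ th m; rewrite m1 (leq_trans lm lM) => /(_ isT) h.
  by have := lt_le_trans h (le_trans tml tlm); rewrite ltxx.
rewrite /in_step m1 mM lexx /=; apply/implyP => lt; apply: chpt_lt.
by rewrite m1.
Qed.

Lemma step_of_chpt m : (1 <= m <= M)%N -> step_of th (t m) = m.
Proof.
move=> mM; rewrite /step_of; case: pickP => [l|] /=.
  by rewrite in_step_chpt // => /eqP.
have /andP[_ mM'] := mM; rewrite -ltnS in mM'.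
by move=> /(_ (Ordinal mM')) /=; rewrite in_step_chpt // eqxx.
Qed.

Lemma partition_chpt m : (1 <= m <= M)%N -> partition (th (t m)) [set: X]%SET.
Proof. by move=> /andP[m1 mM]; apply/theta_partition/chpt_le. Qed.

(** * Tracks of points through the layers *)

Definition track (x : X) (n : nat) : nat * nat :=
  (n, (find (fun C : {set X} => x \in C) (en (th (t n)))).+1).

Lemma in_sankey_V m v :
  (v \in sankey_V th m) = (v.1 == m) && (1 <= v.2 <= #|th (t m)|)%N.
Proof.
apply/imfsetP/idP => [[i /=]|].
  by rewrite mem_iota add1n ltnS => im -> /=; rewrite eqxx.
case: v => n i /= /andP[/eqP-> im]; exists i => //=.
by rewrite mem_iota add1n ltnS.
Qed.

(** The clusters of a partition cover [X], so that the track of [x] has a vertex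
    in layer [m], and are disjoint, so that it has only one. *)
Lemma on_track x m v : (1 <= m <= M)%N ->
  (v \in sankey_V th m) && (x \in cluster th en v) = (v == track x m).
Proof.
move=> mM; rewrite in_sankey_V /cluster; case: v => n i /=.
rewrite /track xpair_eqE -!andbA; case: eqP => //= ->.
have sz : size (en (th (t m))) = #|th (t m)|.
  by rewrite (perm_size (clustersP en _)) cardE.
case: i => [|i] //=; rewrite -sz eqSS.
exact: unique_cluster (partition_chpt mM) (clustersP en _).
Qed.

Lemma track_in x m : (1 <= m <= M)%N -> track x m \in sankey_V th m.
Proof. by move=> mM; have := on_track x (track x m) mM; rewrite eqxx => /andP[]. Qed.

Lemma track_cluster x m : (1 <= m <= M)%N -> x \in cluster th en (track x m).
Proof. by move=> mM; have := on_track x (track x m) mM; rewrite eqxx => /andP[]. Qed.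

Lemma track_neq x m n : m != n -> track x m != track x n.
Proof. by move=> mn; rewrite xpair_eqE negb_and mn. Qed.

(** The track through a given vertex is that of any point of its cluster,
    because the clusters of a partition are nonempty. *)
Lemma sankey_VP m v : (1 <= m <= M)%N ->
  reflect (exists x, v = track x m) (v \in sankey_V th m).
Proof.
move=> mM; apply: (iffP idP) => [vV|[x ->]]; last exact: track_in.
have [x xv] : exists x, x \in cluster th en v.
  apply/set0Pn; have /and3P[_ _] := partition_chpt mM; apply: contraNneq => <-.
  move: vV; rewrite in_sankey_V /cluster => /andP[/eqP->].
  case: (v.2) => [|i] //= im.
  by rewrite -mem_enum -(perm_mem (clustersP en _)) mem_nth //
    (perm_size (clustersP en _)) -cardE.
by exists x; apply/eqP; rewrite -on_track // vV.
Qed.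

Lemma sankey_EP m e : (1 <= m < M)%N ->
  reflect (exists x, e = (track x m, track x m.+1)) (e \in sankey_E th en m).
Proof.
move=> /andP[m1 mM]; have mM1 : (1 <= m <= M)%N by rewrite m1 ltnW.
rewrite /sankey_E !inE /=; apply: (iffP andP).
  case: e => v w /= [/andP[vV wV] /set0Pn[x]]; rewrite inE => /andP[xv xw].
  exists x; congr (_, _); apply/eqP; rewrite -on_track ?vV ?wV //.
move=> [x ->] /=; rewrite !track_in //; split=> //.
by apply/set0Pn; exists x; rewrite inE !track_cluster.
Qed.

(** * The nerve *)

Lemma in_layer_range l m v :
  (v \in layer_range th l m) = (l <= v.1 <= m)%N && (v \in sankey_V th v.1).
Proof.
apply/bigfcupP/andP => [[n]|[vlm vV]].
  rewrite andbT mem_index_iota ltnS => nlm vV.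
  by move: (vV); rewrite in_sankey_V => /andP[/eqP nE _]; rewrite nE nlm vV.
by exists v.1 => //; rewrite andbT mem_index_iota ltnS.
Qed.

(** Clusters with a common point [x] are the clusters along the track of [x]. *)
Lemma nerveP l m s : (1 <= l)%N -> (l <= m)%N -> (m <= M)%N ->
  reflect (s != fset0 /\
           exists x, forall v, v \in s -> (l <= v.1 <= m)%N /\ v = track x v.1)
          (s \in K (t l) (t m)).
Proof.
move=> l1 lm mM.
have range n : (l <= n <= m)%N -> (1 <= n <= M)%N.
  by move=> /andP[ln nm]; rewrite (leq_trans l1 ln) (leq_trans nm mM).
rewrite /nerve_MCbiF !step_of_chpt ?range ?leqnn ?lm // !inE /= fpowersetE.
apply: (iffP and3P) => [[/fsubsetP sR s0 /set0Pn[x]]|[s0 [x sx]]].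
  rewrite in_bigcap_seq => /allP xs; split=> //; exists x => v vs.
  have := sR v vs; rewrite in_layer_range => /andP[vlm vV]; split=> //.
  by apply/eqP; rewrite -on_track ?range // vV xs.
split=> //.
  apply/fsubsetP => v /sx[vlm ->]; rewrite in_layer_range /= vlm.
  exact/track_in/range.
apply/set0Pn; exists x; rewrite in_bigcap_seq; apply/allP => v /sx[vlm ->].
exact/track_cluster/range.
Qed.

Lemma nerve_simplicial l m : (1 <= l)%N -> (l <= m)%N -> (m <= M)%N ->
  simplicial_complex (K (t l) (t m)).
Proof.
move=> l1 lm mM s /(nerveP _ l1 lm mM)[s0 [x sx]]; split=> // r r0 /fsubsetP rs.
by apply/nerveP => //; split=> //; exists x => v /rs/sx.
Qed.

Lemma nerve_mono l l' m m' : (1 <= l')%N -> (l' <= l)%N -> (l <= m)%N ->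
  (m <= m')%N -> (m' <= M)%N -> K (t l) (t m) `<=` K (t l') (t m').
Proof.
move=> l'1 ll lm mm m'M; have l1 := leq_trans l'1 ll; have mM := leq_trans mm m'M.
apply/fsubsetP => s /(nerveP _ l1 lm mM)[s0 [x sx]].
apply/nerveP => //; first exact: leq_trans ll (leq_trans lm mm).
split=> //; exists x => v /sx[/andP[lv vm] ?]; split=> //.
by rewrite (leq_trans ll lv) (leq_trans vm mm).
Qed.

Lemma nerve_vertices m : (1 <= m <= M)%N ->
  graph_complex (sankey_V th m) fset0 = K (t m) (t m).
Proof.
move=> mM; have /andP[m1 m2] := mM; apply/fsetP => s.
apply/graph_complexP/nerveP => //.
  move=> [[v /(sankey_VP _ mM)[x ->] ->]|[e]]; last by rewrite in_fset0.
  split; first by apply/fset0Pn; exists (track x m); rewrite in_fset1.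
  by exists x => _ /fset1P->; rewrite leqnn.
move=> [s0 [x sx]]; left; exists (track x m); first exact: track_in.
apply: sub_fset1 => //; apply/fsubsetP => v /sx[].
by rewrite -eqn_leq => /eqP<- {1}->; rewrite in_fset1.
Qed.

Lemma nerve_edges m : (1 <= m < M)%N ->
  graph_complex (sankey_V th m `|` sankey_V th m.+1) (sankey_E th en m)
    = K (t m) (t m.+1).
Proof.
move=> mM; have /andP[m1 m2] := mM.
have mM1 : (1 <= m <= M)%N by rewrite m1 ltnW.
apply/fsetP => s; apply/graph_complexP/nerveP => //.
  move=> [[v]|[e /(sankey_EP _ mM)[x ->] ->]].
    rewrite in_fsetU => /orP[/sankey_VP|/sankey_VP] [] // x -> -> /=; split.
    - by apply/fset0Pn; exists (track x m); rewrite in_fset1.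
    - by exists x => _ /fset1P->; rewrite /= leqnn leqnSn.
    - by apply/fset0Pn; exists (track x m.+1); rewrite in_fset1.
    - by exists x => _ /fset1P->; rewrite /= leqnn leqnSn.
  split; first by apply/fset0Pn; exists (track x m); rewrite in_fset2 eqxx.
  by exists x => _ /fset2P[]->; rewrite /= leqnn leqnSn.
move=> [s0 [x sx]].
have : s `<=` [fset track x m; track x m.+1].
  apply/fsubsetP => v /sx[]; rewrite in_fset2 => /andP[].
  rewrite leq_eqVlt => /predU1P[<- _ {1}->|mv vm ->]; first by rewrite eqxx.
  by rewrite (_ : v.1 = m.+1) ?eqxx ?orbT //; apply/eqP; rewrite eqn_leq vm.
case/(sub_fset2 s0) => ->; [left|left|right].
- by exists (track x m) => //; rewrite in_fsetU track_in.
- by exists (track x m.+1) => //; rewrite in_fsetU orbC track_in.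
- by exists (track x m, track x m.+1) => //; apply/sankey_EP => //; exists x.
Qed.

(** * The Sankey diagram *)

Lemma sankey_VsP v :
  reflect (exists m x, (1 <= m <= M)%N /\ v = track x m)
          (v \in \bigcup_(V <- layers (sankey th en)) V).
Proof.
apply: (iffP (bigfcupP _ _ _ _)) => [[V]|[m [x [mM ->]]]].
  rewrite andbT => /mapP[m]; rewrite mem_iota add1n ltnS => mM ->.
  by case/(sankey_VP _ mM) => x ->; exists m, x.
exists (sankey_V th m); last exact: track_in.
by rewrite andbT; apply: map_f; rewrite mem_iota add1n ltnS.
Qed.

Lemma sankey_EsP e :
  reflect (exists m x, (1 <= m < M)%N /\ e = (track x m, track x m.+1))
          (e \in \bigcup_(E <- layer_edges (sankey th en)) E).
Proof.
have iotaE m : (m \in iota 1 M.-1) = (1 <= m < M)%N.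
  by rewrite mem_iota add1n prednK // nchange_gt0.
apply: (iffP (bigfcupP _ _ _ _)) => [[E]|[m [x [mM ->]]]].
  rewrite andbT => /mapP[m]; rewrite iotaE => mM ->.
  by case/(sankey_EP _ mM) => x ->; exists m, x.
exists (sankey_E th en m); last by apply/sankey_EP => //; exists x.
by rewrite andbT; apply: map_f; rewrite iotaE.
Qed.

Lemma sankey_simplicial : simplicial_complex (sankey_complex th en).
Proof.
apply: graph_simplicial => e /sankey_EsP[m [x [/andP[m1 mM] ->]]] /=.
apply/andP; split; apply/sankey_VsP; [exists m, x|exists m.+1, x] => //.
by rewrite m1 ltnW.
Qed.

Lemma sankey_sub_nerve : sankey_complex th en `<=` K (t 1%N) (t M).
Proof.
have M0 := nchange_gt0 th.
apply/fsubsetP => s /graph_complexP[[v /sankey_VsP[m [x [mM ->]]] ->]|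
  [e /sankey_EsP[m [x [/andP[m1 mM] ->]]] ->]]; apply/nerveP => //; split.
- by apply/fset0Pn; exists (track x m); rewrite in_fset1.
- by exists x => _ /fset1P->.
- by apply/fset0Pn; exists (track x m); rewrite in_fset2 eqxx.
- by exists x => _ /fset2P[]->; rewrite /= ?m1 ?mM ?(ltnW mM).
Qed.

Lemma sankey_has_dim1 : (2 <= M)%N -> (0 < #|X|)%N ->
  has_dim (sankey_complex th en) 1.
Proof.
move=> M2 /card_gt0P[x _]; split; first exact: graph_dim_le1.
exists [fset track x 1; track x 2]; last by rewrite cardfs2 track_neq.
apply/graph_complexP; right; exists (track x 1, track x 2) => //.
by apply/sankey_EsP; exists 1%N, x.
Qed.

Lemma sankey_proper_nerve : (3 <= M)%N -> (0 < #|X|)%N ->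
  sankey_complex th en `<` K (t 1%N) (t M).
Proof.
move=> M3 /card_gt0P[x _]; rewrite fproperE sankey_sub_nerve /=.
pose s := track x 1 |` [fset track x 2; track x 3].
have s3 : #|` s| = 3.
  by rewrite cardfsU1 cardfs2 in_fset2 negb_or !track_neq.
apply/negP => /fsubsetP/(_ s) sS.
suff /sS/graph_dim_le1 : s \in K (t 1%N) (t M) by rewrite s3.
apply/nerveP => //; first exact: nchange_gt0.
split; first by rewrite -cardfs_gt0 s3.
exists x => v; rewrite in_fset1U in_fset2.
by case/or3P => /eqP-> /=; rewrite ?(ltnW M3) ?(ltnW (ltnW M3)).
Qed.

(** * The zigzag *)

Lemma size_zigzag : size (sankey_zigzag th en) = M.*2.-1.
Proof. exact: size_mkseq. Qed.

(** Each term of the zigzag spans the layers [k./2.+1] to [(uphalf k).+1], which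
    is one layer for even [k] and two for odd [k]. *)
Lemma zigzag_range k : (k < M.*2.-1)%N ->
  (k./2 <= uphalf k)%N /\ (uphalf k < M)%N.
Proof.
move=> kM; rewrite uphalf_half leq_addl; split=> //.
rewrite -uphalf_half ltn_uphalf_double.
by have := nchange_gt0 th; move: kM; case: M => // n; rewrite doubleS.
Qed.

Lemma nth_zigzag k : (k < M.*2.-1)%N ->
  nth fset0 (sankey_zigzag th en) k = K (t k./2.+1) (t (uphalf k).+1).
Proof. by move=> kM; rewrite nth_mkseq. Qed.

Lemma zigzag_term_mono k k' : (k' < M.*2.-1)%N -> (k < M.*2.-1)%N ->
  (k'./2 <= k./2)%N -> (uphalf k <= uphalf k')%N ->
  nth fset0 (sankey_zigzag th en) k `<=` nth fset0 (sankey_zigzag th en) k'.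
Proof.
move=> k'M kM h u; rewrite !nth_zigzag //; have [] := zigzag_range kM.
by have [_ ?] := zigzag_range k'M; move=> *; apply: nerve_mono.
Qed.

Lemma even_step k : ~~ odd k -> (k.+1./2 = k./2) /\ (uphalf k.+1 = (uphalf k).+1).
Proof. by move=> ek; rewrite -[k.+1./2]/(uphalf k) /= uphalf_half (negPf ek). Qed.

Lemma odd_step k : odd k -> (k.+1./2 = k./2.+1) /\ (uphalf k.+1 = uphalf k).
Proof. by move=> ok; rewrite -[k.+1./2]/(uphalf k) /= uphalf_half ok. Qed.

Lemma zigzag_is_zigzag :
  zigzag_filtration (fun k => ~~ odd k) (sankey_zigzag th en).
Proof.
split=> [L /(nthP fset0)[k]|k].
  rewrite size_zigzag => kM <-; rewrite nth_zigzag //.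
  by have [] := zigzag_range kM; move=> *; apply: nerve_simplicial.
rewrite size_zigzag => kM; have kM' := ltnW kM.
case: ifP => [/even_step[hE uE]|/negbFE/odd_step[hE uE]].
  by apply: zigzag_term_mono; rewrite ?hE ?uE.
by apply: zigzag_term_mono; rewrite ?hE ?uE.
Qed.

Lemma zigzag_subfiltration :
  subfiltration (t 1%N) K (fun k => ~~ odd k) (sankey_zigzag th en).
Proof.
exists (mkseq (fun k => (t k./2.+1, t (uphalf k).+1)) M.*2.-1); split.
- move=> q /mapP[k]; rewrite mem_iota => /zigzag_range[hu uM] -> /=.
  by rewrite !chpt_le // (leq_ltn_trans hu).
- by rewrite /sankey_zigzag /mkseq -map_comp.
move=> k; rewrite size_mkseq => kM; have kM' := ltnW kM.
have [hu uM] := zigzag_range kM'; have [hu' uM'] := zigzag_range kM.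
have hM := leq_ltn_trans hu uM; have hM' := leq_ltn_trans hu' uM'.
have bileE (a b c d : R) : bile (a, b) (c, d) = (c <= a) && (b <= d) by [].
rewrite !nth_mkseq // !bileE.
case: ifP => [/even_step[hE uE]|/negbFE/odd_step[hE uE]];
  by rewrite hE uE in hM' uM' *; rewrite !chpt_le.
Qed.

Lemma vertex_set_nerve m : (1 <= m <= M)%N ->
  vertex_set (K (t m) (t m)) = sankey_V th m.
Proof.
move=> mM; rewrite -nerve_vertices //; apply/fsetP => v.
apply/bigfcupP/idP => [[s]|vV].
  rewrite andbT => /graph_complexP[[w wV ->] /fset1P->//|[e]].
  by rewrite in_fset0.
exists [fset v]; rewrite ?in_fset1 // andbT.
by apply/graph_complexP; left; exists v.
Qed.

Lemma edges_of_nerve m : (1 <= m < M)%N ->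
  [fset e in sankey_V th m `*` sankey_V th m.+1 |
    [fset e.1; e.2] \in K (t m) (t m.+1)] = sankey_E th en m.
Proof.
move=> mM; have /andP[m1 m2] := mM.
have mM1 : (1 <= m <= M)%N by rewrite m1 ltnW.
apply/fsetP => e; rewrite in_edges; apply/and3P/(sankey_EP _ mM) => [[e1 e2]|[x ->] /=].
  move=> /nerveP[]// _ [x ex]; exists x.
  move: e1 e2; rewrite !in_sankey_V => /andP[/eqP e1 _] /andP[/eqP e2 _].
  have [_] := ex e.1 (fset21 _ _); have [_] := ex e.2 (fset22 _ _).
  by rewrite e1 e2; case: e {e1 e2 ex} => v w /= -> ->.
rewrite !track_in //; split=> //; rewrite -nerve_edges //.
apply/graph_complexP; right; exists (track x m, track x m.+1) => //.
by apply/sankey_EP => //; exists x.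
Qed.

Lemma retrieve_zigzag : retrieve (sankey_zigzag th en) = sankey th en.
Proof.
have M0 := nchange_gt0 th.
have iota1 n : iota 1 n = map succn (iota 0 n) by rewrite (iotaDl 1 0).
have evenE k : (k < M)%N ->
    vertex_set (nth fset0 (sankey_zigzag th en) k.*2) = sankey_V th k.+1.
  move=> kM; rewrite nth_zigzag ?doubleK ?uphalf_double ?vertex_set_nerve //.
  by rewrite -ltnS prednK ?double_gt0 // -doubleS leq_double.
have -> : sankey th en =
    LayeredGraph (mkseq (fun k => sankey_V th k.+1) M)
                 (mkseq (fun k => sankey_E th en k.+1) M.-1).
  by rewrite /sankey /mkseq !iota1 -!map_comp.
have [hM uM] : M.*2.-1./2 = M.-1 /\ uphalf M.*2.-1 = M.
  by case: M M0 => // n _; rewrite doubleS /= uphalf_double doubleK.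
rewrite /retrieve size_zigzag hM uM; congr LayeredGraph.
  by apply/eq_in_map => k; rewrite mem_iota => /evenE.
apply/eq_in_map => k; rewrite mem_iota /= add0n => kM.
have k1M : (k.+1 < M)%N by rewrite -ltn_predRL.
rewrite !evenE ?(ltnW k1M) // nth_zigzag /= ?uphalf_double ?doubleK.
  exact: edges_of_nerve.
by rewrite -ltnS prednK ?double_gt0 // -doubleS ltn_double.
Qed.

End SankeyNerve.

(** * The Sankey diagram inside the nerve *)

Theorem proposition17 (R : realType) (X : finType)
    (th : partition_sequence R X) (en : cluster_enumeration X) :
  let M := nchange th in
  let t := chpt th in
  let K := nerve_MCbiF th en in
  let S := sankey_complex th en in
  let Z := sankey_zigzag th en in
  let fwd := fun k : nat => ~~ odd k in
  (* S is a strict 1-dimensional subcomplex of K(t1,tM) *)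
  (subcomplex S (K (t 1%N) (t M)) /\
   dim_le S 1 /\
   ((2 <= M)%N -> (0 < #|X|)%N -> has_dim S 1) /\
   ((3 <= M)%N -> (0 < #|X|)%N -> S `<` K (t 1%N) (t M))) /\
  (* V_m = K(t_m,t_m) and E_m = K(t_m,t_{m+1}) *)
  (forall m : nat, (1 <= m <= M.-1)%N ->
     graph_complex (sankey_V th m) fset0 = K (t m) (t m) /\
     graph_complex (sankey_V th m `|` sankey_V th m.+1) (sankey_E th en m)
       = K (t m) (t m.+1)) /\
  (* the zigzag is a subfiltration of the bifiltration, and determines the
     Sankey diagram *)
  zigzag_filtration fwd Z /\
  subfiltration (t 1%N) K fwd Z /\
  retrieve Z = sankey th en.
Proof.
move=> M t K S Z fwd; have M0 : (0 < M)%N := nchange_gt0 th.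
split; first split.
- by split; [exact: sankey_simplicial | exact: nerve_simplicial
            | exact: sankey_sub_nerve].
- split; first exact: graph_dim_le1.
  by split; [exact: sankey_has_dim1 | exact: sankey_proper_nerve].
split=> [m /andP[m1 mM]|].
  have mM' : (m < M)%N by rewrite -(prednK M0) ltnS.
  by rewrite (nerve_vertices en) ?nerve_edges ?m1 ?(ltnW mM').
split; first exact: zigzag_is_zigzag.
by split; [exact: zigzag_subfiltration | exact: retrieve_zigzag].
Qed.
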